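(* Let $\chi$ denote the chromatic number of the Euclidean plane $\mathbb{R}^2$. Then $\chi \ge 5$. Equivalently, for every function $c:\mathbb{R}^2\to\{1,2,3,4\}$ there exist points $x,y\in\mathbb{R}^2$ with Euclidean distance $\|x-y\|=1$ and $c(x)=c(y)$.
   Context: The chromatic number $\chi$ of the plane is the smallest number $k$ of colors for which there is a coloring $c:\mathbb{R}^2\to\{1,\dots,k\}$ of all points of the Euclidean plane such that any two points at Euclidean distance exactly $1$ receive different colors (such a coloring is called proper). No regularity is required of the color classes. *)

(* Defs.v *)
From mathcomp Require Import all_boot all_order all_algebra.
From mathcomp Require Import boolp reals.
From mathcomp Require Import zify ring lra.
Set Implicit Arguments.
Unset Strict Implicit.
Unset Printing Implicit Defensive.
Import Order.TTheory GRing.Theory Num.Theory.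
Local Open Scope ring_scope.

(* The norm [`| _ |] that the library puts on ['rV_n] is the sup norm, hence
   this separate definition. *)
Definition euclidean_norm (R : realType) (n : nat) (v : 'rV[R]_n) : R :=
  Num.sqrt (\sum_(i < n) v 0 i ^+ 2).

(* The [k] colors {1, ..., k} are represented by ['I_k] = {0, ..., k - 1}. *)
Definition proper_coloring (R : realType) (k : nat) (c : 'rV[R]_2 -> 'I_k) :
    Prop :=
  forall x y : 'rV[R]_2, euclidean_norm (x - y) = 1 -> c x <> c y.

Definition plane_colorable (R : realType) (k : nat) : Prop :=
  exists c : 'rV[R]_2 -> 'I_k, proper_coloring c.

Lemma same_cell (R : realType) (s t : R) :
  (s - t) ^+ 2 <= 1 ->
  (Num.floor (2 * s) %% 3)%Z = (Num.floor (2 * t) %% 3)%Z ->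
  (s - t) ^+ 2 < 1 / 4.
Proof.
move=> st1 emod.
have /andP[sl su] := real_floor_itv (num_real (2 * s)).
have /andP[tl tu] := real_floor_itv (num_real (2 * t)).
set a := Num.floor (2 * s) in emod sl su.
set b := Num.floor (2 * t) in emod tl tu.
rewrite !intrD !mulr1z in su tu.
have lo : -1 <= s - t by nra.
have hi : s - t <= 1 by nra.
have ab : a < b + 3.
  by rewrite -(ltr_int R) intrD; change (3%:~R : R) with (3 : R); lra.
have ba : b < a + 3.
  by rewrite -(ltr_int R) intrD; change (3%:~R : R) with (3 : R); lra.
have eab : a = b by lia.
rewrite eab in sl su.
nra.
Qed.

(* Color the half-open squares of side 1/2 periodically, with period 3 in each
   direction: two points of the same color are in the same square, or at
   distance greater than 1. *)
Lemma plane_finitely_colorable (R : realType) :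
  exists k : nat, `[< plane_colorable R k >].
Proof.
pose res (s : R) : 'I_3 := inord `|(Num.floor (2 * s) %% 3)%Z|%N.
have resP s t : res s = res t ->
    (Num.floor (2 * s) %% 3)%Z = (Num.floor (2 * t) %% 3)%Z.
  by move=> /(congr1 val); rewrite /= !inordK; lia.
pose col (x : 'rV[R]_2) : 'I_3 * 'I_3 := (res (x 0 0), res (x 0 1)).
exists #|{: 'I_3 * 'I_3}|; apply/asboolP; exists (fun x => enum_rank (col x)).
move=> x y dxy /enum_rank_inj[/resP e0 /resP e1].
have d2 : (x 0 0 - y 0 0) ^+ 2 + (x 0 1 - y 0 1) ^+ 2 = 1.
  move: dxy; rewrite /euclidean_norm !big_ord_recl big_ord0 addr0 !mxE.
  have -> : lift ord0 ord0 = 1 :> 'I_2 by apply/val_inj.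
  move=> d; rewrite -[LHS]sqr_sqrtr ?addr_ge0 ?sqr_ge0 //.
  by rewrite d expr1n.
have p0 := sqr_ge0 (x 0 0 - y 0 0).
have p1 := sqr_ge0 (x 0 1 - y 0 1).
have q0 : (x 0 0 - y 0 0) ^+ 2 < 1 / 4 by apply: same_cell e0; lra.
have q1 : (x 0 1 - y 0 1) ^+ 2 < 1 / 4 by apply: same_cell e1; lra.
lra.
Qed.

Definition chromatic_number_plane (R : realType) : nat :=
  ex_minn (plane_finitely_colorable R).

(* Main.v *)
From Stdlib Require Import ZArith FMapPositive.
Require Import Defs.
From mathcomp Require Import all_boot all_order all_algebra.
From mathcomp Require Import reals.
From mathcomp Require Import perm boolp ssrZ zify ring lra.

(** A lemma-by-lemma version of de Grey's proof. Let [c] be a proper 4-coloring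
    of the plane. In the field generated by the square roots of 3 and 11, a
    point surrounded by a monochromatic equilateral triangle of side sqrt 3
    cannot be extended to a proper coloring of an 859-point unit-distance graph,
    so [c] has no such triangle anywhere. In the field generated by the square
    roots of 3 and 15, a 61-point graph made of two discs of the triangular
    lattice, one rotated so that the points at distance 2 from the common center
    move by distance 1, has no proper coloring that avoids these triangles and
    gives different colors to two opposite points at distance 4. Hence [c] takes
    equal values at distance 4, which is absurd in a triangle with sides 4, 4, 1.

    With unit propagation, fewer than 200 branchings refute either graph. *)

Set Implicit Arguments.
Unset Strict Implicit.
Unset Printing Implicit Defensive.
Import Order.TTheory GRing.Theory Num.Theory.

(* [%Z] denotes MathComp's [int_scope] here. *)
Delimit Scope Z_scope with BZ.
Local Open Scope nat_scope.

(** * Refutation by branching and unit propagation *)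

Definition get A (x0 : A) (m : PositiveMap.t A) (v : positive) : A :=
  if PositiveMap.find v m is Some x then x else x0.

Lemma get_empty A (x0 : A) v : get x0 (PositiveMap.empty A) v = x0.
Proof. by rewrite /get PositiveMap.gempty. Qed.

Lemma get_add A (x0 : A) m v w x :
  get x0 (PositiveMap.add v x m) w = if Pos.eqb w v then x else get x0 m w.
Proof.
rewrite /get; case: Pos.eqb_spec => [-> | ne]; first by rewrite PositiveMap.gss.
by rewrite PositiveMap.gso.
Qed.

Definition domains := PositiveMap.t (seq nat).
Definition dom (d : domains) (v : positive) : seq nat := get [:: 0; 1; 2; 3] d v.

(* The entry at [v] lists, for every nogood (a set of vertices that must not be
   monochromatic) through [v], its vertices other than [v]. *)
Definition nogoods := PositiveMap.t (seq (seq positive)).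

Definition forced (c : nat) (s : seq nat) : bool :=
  if s is [:: c'] then eqn c' c else false.

Fixpoint unforced (d : domains) (c : nat) (l : seq positive) :
    seq (positive * seq nat) :=
  if l is v :: l' then
    let s := dom d v in
    if forced c s then unforced d c l' else (v, s) :: unforced d c l'
  else [::].

(** One step of unit propagation after some vertex receives [c]: [None] signals a conflict, and [q]
    collects the vertices whose color becomes known. *)
Fixpoint exclude (c : nat) (ls : seq (seq positive)) (d : domains)
    (q : seq (positive * nat)) : option (domains * seq (positive * nat)) :=
  match ls with
  | [::] => Some (d, q)
  | l :: ls' =>
    match unforced d c l with
    | [::] => None
    | [:: (v, s)] =>
      if has (eqn c) s then
        match [seq x <- s | ~~ eqn c x] with
        | [::] => None
        | [:: x] => exclude c ls' (PositiveMap.add v [:: x] d) ((v, x) :: q)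
        | s' => exclude c ls' (PositiveMap.add v s' d) q
        end
      else exclude c ls' d q
    | _ => exclude c ls' d q
    end
  end.

(** Running out of fuel only returns weaker domains, which is harmless for a refutation. *)
Fixpoint propagate (ng : nogoods) (fuel : nat) (d : domains)
    (q : seq (positive * nat)) : option domains :=
  match fuel, q with
  | k.+1, (v, c) :: q' =>
    if exclude c (get [::] ng v) d q' is Some (d', q'')
    then propagate ng k d' q'' else None
  | _, _ => Some d
  end.

Definition branch ng fuel (v : positive) (d : domains) (st : seq domains) :
    seq domains :=
  foldr (fun c st' =>
    if propagate ng fuel (PositiveMap.add v [:: c] d) [:: (v, c)] is Some d'
    then d' :: st' else st') st (dom d v).

(* [bs] gives the branching vertices of the search tree in depth-first order;
   [st] is the stack of the nodes that are still open. *)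
Fixpoint refute ng fuel (bs : seq positive) (st : seq domains) : bool :=
  match bs, st with
  | [::], [::] => true
  | v :: bs', d :: st' => refute ng fuel bs' (branch ng fuel v d st')
  | _, _ => false
  end.

Section Soundness.
Variables (f : positive -> nat) (ng : nogoods) (fuel : nat).

Definition admits (d : domains) : Prop := forall v, f v \in dom d v.

Definition settled (q : seq (positive * nat)) : bool := all (fun x => f x.1 == x.2) q.

Definition avoids (c : nat) (ls : seq (seq positive)) : bool :=
  all (has (fun w => f w != c)) ls.

Hypothesis ng_avoided : forall v, avoids (f v) (get [::] ng v).

Lemma admits_add d v s : admits d -> f v \in s -> admits (PositiveMap.add v s d).
Proof.
by move=> fd fs w; rewrite /dom get_add; case: Pos.eqb_spec => [-> | _].
Qed.

Lemma unforced_dom d c l : all (fun x => x.2 == dom d x.1) (unforced d c l).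
Proof. by elim: l => //= v l IHl; case: ifP => _ //=; rewrite eqxx. Qed.

Lemma unforced_has d c l : admits d -> has (fun w => f w != c) l ->
  has (fun x => f x.1 != c) (unforced d c l).
Proof.
move=> fd; elim: l => //= v l IHl; case: ifP => /= [s1 | _].
  case/orP => [|/IHl //]; move: s1 (fd v); rewrite /forced.
  by case: (dom d v) => [|c' [|? ?]] //; rewrite eqnE inE => /eqP-> ->.
by case/orP => [-> // | /IHl->]; rewrite orbT.
Qed.

(** Every nogood contains a vertex that [f] does not color [c], so no conflict arises and a color
    struck out is never the one given by [f]. *)
Lemma exclude_sound c ls d q : avoids c ls -> admits d -> settled q ->
  exists d' q', [/\ exclude c ls d q = Some (d', q'), admits d' & settled q'].
Proof.
elim: ls d q => [|l ls IHls] d q /=; first by exists d, q.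
case/andP=> cl cls fd fq.
have := unforced_has fd cl; have := unforced_dom d c l.
case: (unforced d c l) => [|[v s] [|? ?]] //=; last by move=> _ _; apply: IHls.
rewrite andbT orbF => /eqP-> fvc.
case: ifP => _; last exact: IHls.
have : f v \in [seq x <- dom d v | ~~ eqn c x].
  by rewrite mem_filter eqnE eq_sym fvc fd.
case: [seq x <- dom d v | ~~ eqn c x] => [|x [|y s']] //.
  rewrite inE => /eqP fx; apply: IHls => //; last by rewrite /= fx eqxx.
  by apply: admits_add; rewrite // inE fx.
by move=> fs; apply: IHls => //; apply: admits_add.
Qed.

Lemma propagate_sound k d q : admits d -> settled q ->
  exists2 d', propagate ng k d q = Some d' & admits d'.
Proof.
elim: k d q => [|k IHk] d q fd; first by exists d.
case: q => [|[v c] q] /=; first by exists d.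
case/andP=> /eqP <- fq.
by have [d' [q' [-> fd' fq']]] := exclude_sound (ng_avoided v) fd fq; apply: IHk.
Qed.

Lemma branch_sound v d st :
  admits d \/ (exists2 d', List.In d' st & admits d') ->
  exists2 d', List.In d' (branch ng fuel v d st) & admits d'.
Proof.
rewrite /branch; case=> [fd | [d' d'st fd']].
  have := fd v; elim: (dom d v) => //= c s IHs; rewrite inE.
  case/predU1P => [fv | /IHs[d' d's fd']].
    have [||d' -> fd'] := @propagate_sound fuel (PositiveMap.add v [:: c] d) [:: (v, c)].
    - by apply: admits_add; rewrite // inE fv.
    - by rewrite /= fv eqxx.
    by exists d' => //; left.
  by exists d' => //; case: propagate => // ?; right.
exists d' => //; elim: (dom d v) => //= c s IHs.
by case: propagate => // ?; right.
Qed.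

(** A node that admits [f] always has a child that does, so with such a node the stack could not
    become empty. *)
Lemma refute_sound bs st : refute ng fuel bs st ->
  ~ exists2 d, List.In d st & admits d.
Proof.
elim: bs st => [|v bs IHbs] [|d st] //=.
  by move=> _ [d []].
move/IHbs => nost [d' [<- | d'st] fd']; apply: nost; apply: branch_sound.
  by left.
by right; exists d'.
Qed.

End Soundness.

(** * Unit-distance graphs over biquadratic fields *)

(* With parameters [m] and [D], the quadruple (a, b, c, d) stands for the complex
   number (a + b i sqrt 3 + c i sqrt m + d sqrt (3 m)) / D. *)
Definition pt : Type := (Z * Z * Z * Z)%type.

Definition origin : pt := (0, 0, 0, 0)%BZ.

Definition padd (p q : pt) : pt :=
  let: (a, b, c, d) := p in let: (a', b', c', d') := q in
  (a + a', b + b', c + c', d + d')%BZ.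

Definition psub (p q : pt) : pt :=
  let: (a, b, c, d) := p in let: (a', b', c', d') := q in
  (a - a', b - b', c - c', d - d')%BZ.

Definition peq (p q : pt) : bool :=
  let: (a, b, c, d) := p in let: (a', b', c', d') := q in
  [&& Z.eqb a a', Z.eqb b b', Z.eqb c c' & Z.eqb d d'].

(* The divisions by 2 are exact on the points used below. *)
Definition rot60 (p : pt) : pt :=
  let: (a, b, c, d) := p in
  (Z.div2 (a - 3 * b), Z.div2 (a + b), Z.div2 (c + 3 * d), Z.div2 (d - c))%BZ.

(* (r, s) stands for (r + 2 s sqrt (3 m)) / D^2. *)
Definition sqnorm (m : Z) (p : pt) : Z * Z :=
  let: (a, b, c, d) := p in
  (a * a + 3 * (b * b) + m * (c * c) + 3 * m * (d * d), a * d + b * c)%BZ.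

Definition sqdist_is (m n : Z) (p q : pt) : bool :=
  let: (r, s) := sqnorm m (psub p q) in Z.eqb r n && Z.eqb s 0.

Definition orbit6 (p : pt) : seq pt := traject rot60 p 6.

Definition hexagon (e : pt) : seq pt := origin :: orbit6 e.

Definition minkowski (s t : seq pt) : seq pt := [seq padd p q | p <- s, q <- t].

Definition edge (m D : Z) (l : seq pt) : bool :=
  (size l == 2) && pairwise (sqdist_is m (D * D)) l.

Definition triangle (m D : Z) (l : seq pt) : bool :=
  (size l == 3) && pairwise (sqdist_is m (3 * (D * D))) l.

(* Injective only for coordinates in [-64, 64); a collision would lose points or
   nogoods, hence could not make a refutation unsound. *)
Definition key (p : pt) : positive :=
  let: (a, b, c, d) := p in
  Z.to_pos ((((a + 64) * 128 + (b + 64)) * 128 + (c + 64)) * 128 + (d + 64))%BZ.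

Record point_index := PointIndex {
  next_index : positive;
  positions : PositiveMap.t positive;
  points : PositiveMap.t pt }.

Definition index_points (ps : seq pt) : point_index :=
  foldl (fun ix p =>
    let k := key p in
    if PositiveMap.mem k (positions ix) then ix else
    let n := next_index ix in
    PointIndex (Pos.succ n) (PositiveMap.add k n (positions ix))
      (PositiveMap.add n p (points ix)))
    (PointIndex 1 (PositiveMap.empty _) (PositiveMap.empty _)) ps.

Definition find_point (ix : point_index) (p : pt) : option positive :=
  PositiveMap.find (key p) (positions ix).

Definition point_at (ix : point_index) (i : positive) : pt := get origin (points ix) i.

Definition distinct_points (ps : seq pt) : seq pt :=
  [seq x.2 | x <- PositiveMap.elements (points (index_points ps))].

(** Shapes are lists of displacements from [p]. Each candidate is rechecked by [forbidden] on actual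
    coordinates, so soundness rests on neither the shapes nor the index. *)
Definition nogoods_at (forbidden : seq pt -> bool) (shapes : seq (seq pt))
    (ix : point_index) (i : positive) (p : pt) : seq (seq positive) :=
  [seq js <- [seq pmap (fun u => find_point ix (padd p u)) sh | sh <- shapes]
     | forbidden (map (point_at ix) (i :: js))].

Definition all_nogoods forbidden shapes (ix : point_index) : nogoods :=
  foldr (fun x => PositiveMap.add x.1 (nogoods_at forbidden shapes ix x.1 x.2))
    (PositiveMap.empty _) (PositiveMap.elements (points ix)).

Definition locate (ix : point_index) (s : seq (pt * nat)) : seq (positive * nat) :=
  pmap (fun x => if find_point ix x.1 is Some i then
                   if peq (point_at ix i) x.1 then Some (i, x.2) else None
                 else None) s.

Definition uncolorable forbidden shapes (ps : seq pt) (s : seq (pt * nat))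
    (bs : seq positive) : bool :=
  let ix := index_points ps in
  let ng := all_nogoods forbidden shapes ix in
  let fuel := size ps in
  let q := locate ix s in
  let d := foldr (fun x => PositiveMap.add x.1 [:: x.2]) (PositiveMap.empty _) q in
  if propagate ng fuel d q is Some d' then refute ng fuel bs [:: d'] else true.

Lemma peqP (p q : pt) : peq p q -> p = q.
Proof.
move: p q => [[[a b] c] d] [[[a' b'] c'] d'] /=.
by case/and4P => /Z.eqb_eq-> /Z.eqb_eq-> /Z.eqb_eq-> /Z.eqb_eq->.
Qed.

Lemma uncolorable_sound forbidden shapes ps s bs (f : pt -> nat) :
  uncolorable forbidden shapes ps s bs ->
  (forall p, f p < 4) ->
  (forall l, forbidden l -> ~~ constant (map f l)) ->
  all (fun x => f x.1 == x.2) s -> False.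
Proof.
rewrite /uncolorable; set ix := index_points ps.
set ng := all_nogoods _ _ _ => run f4 fl fs; pose g i := f (point_at ix i).
have ngP v : avoids g (g v) (get [::] ng v).
  rewrite /ng /all_nogoods; elim: PositiveMap.elements => [|[i p] e IHe] /=.
    by rewrite get_empty.
  rewrite get_add; case: Pos.eqb_spec => // ->.
  rewrite /nogoods_at /avoids all_filter (eq_all (a2 := predT)) ?all_predT // => js.
  apply/implyP => /fl; rewrite /= -has_predC !has_map.
  by apply: sub_has => j /=; rewrite eq_sym.
have gq : settled g (locate ix s).
  elim: s fs {run} => //= -[p c] s IHs /andP[/= /eqP fp /IHs].
  rewrite /locate /=; case: find_point => //= i.
  by case: ifP => //= /peqP pE; rewrite /g pE fp eqxx.
have fd : admits g (foldr (fun x => PositiveMap.add x.1 [:: x.2])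
                      (PositiveMap.empty _) (locate ix s)).
  elim: (locate ix s) gq => [_ v | [i c] q IHq /= /andP[/= /eqP gi /IHq gq]].
    rewrite /dom get_empty.
    by case: (g v) (f4 (point_at ix v) : g v < 4) => [|[|[|[|]]]].
  by apply: admits_add; rewrite // inE gi.
have [d' dE fd'] := propagate_sound ngP (size ps) fd gq.
by move: run; rewrite dE => /(refute_sound ngP); apply; exists d' => //; left.
Qed.

(** * The two finite graphs and their refutations *)

(* The powers of exponent -2, ..., 2 of (sqrt 33 + i sqrt 3) / 6, the square root
   of the Moser spindle rotation (5 + i sqrt 11) / 6, and their rotations by
   multiples of 60 degrees. *)
Definition unit_vectors : seq pt := flatten [seq orbit6 p | p <-
  [:: (12, 0, 0, 0); (0, 2, 0, 2); (10, 0, 2, 0); (0, -2, 0, 2); (10, 0, -2, 0)]%BZ].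

(* This is |p|^2 <= 3/2 with 4 sqrt 33 rounded to 23: no vector of the sumset is
   close enough to the bound for the rounding to matter. *)
Definition short (p : pt) : bool :=
  let: (r, s) := sqnorm 11 p in (2 * r + 23 * s <=? 432)%BZ.

Definition de_grey_points : seq pt :=
  let V := origin :: unit_vectors in
  minkowski (hexagon (12, 0, 0, 0)%BZ) (distinct_points (filter short (minkowski V V))).

(** Three alternate vertices of the unit hexagon form the triangle of side sqrt 3 around its
    center. *)
Definition de_grey_seeds : seq (pt * nat) :=
  [:: (origin, 0%N); ((12, 0, 0, 0), 1%N);
      ((-6, 6, 0, 0), 1%N); ((-6, -6, 0, 0), 1%N)]%BZ.

(* Found by a lookahead search minimizing the estimated size of the subtrees. The
   numbers are those given to the points by [index_points]. *)
Definition de_grey_branches : seq positive := [::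
    66; 67; 80; 77; 144; 17; 36; 117; 13; 28; 2; 17; 74; 59; 78; 17; 36;
    36; 104; 47; 59; 25; 77; 48; 77; 4; 17; 9; 28; 3; 80; 77; 144; 17; 36;
    117; 13; 28; 17; 74; 2; 59; 78; 17; 36; 36; 47; 104; 59; 77; 4; 17; 9;
    3; 28; 25; 77; 48; 67; 59; 77; 83; 38; 78; 17; 21; 28; 534; 3; 28; 80;
    4; 41; 104; 580; 166; 78; 26; 28; 2; 2; 24; 77; 78; 17; 26; 31; 38;
    78; 77; 70; 260; 2; 80; 59; 28; 59; 59; 17; 26; 5; 16; 70; 35; 154;
    21; 47; 24; 83; 5; 83; 15; 17; 51; 79; 67; 59; 77; 83; 28; 534; 3; 38;
    78; 17; 21; 28; 80; 4; 41; 104; 580; 166; 77; 78; 17; 26; 31; 78; 26;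
    28; 2; 24; 2; 38; 78; 77; 80; 59; 28; 59; 70; 260; 2; 59; 17; 26; 5;
    16; 70; 35; 154; 21; 47; 83; 15; 17; 51; 79; 24; 83; 5]%positive.

Lemma de_grey_uncolorable :
  uncolorable (edge 11 12) [seq [:: u] | u <- unit_vectors]
    de_grey_points de_grey_seeds de_grey_branches.
Proof. by vm_compute. Qed.

(** The threefold sum has 37 lattice points; the cutoff drops the six corners at distance 3. Norms
    in these lattices are rational, so the first component of [sqnorm] suffices. *)
Definition disc (e : pt) : seq pt :=
  let H := hexagon e in
  [seq p <- minkowski H (minkowski H H) | ((sqnorm 15 p).1 <=? 7 * 16 ^ 2)%BZ].

(* The rotation (7 + i sqrt 15) / 8 by 2 arcsin (1/4) moves the points at distance
   2 from the origin by distance 1. *)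
Definition linked_points : seq pt :=
  disc (16, 0, 0, 0)%BZ ++ disc (14, 0, 2, 0)%BZ.

(** [(-4, 0, 4, 0)] joins a point at distance 2 to its rotated copy. The vector [u + rot60 u] has
    length sqrt 3, and with its rotation by 60 degrees it spans a forbidden triangle. *)
Definition linked_shapes : seq (seq pt) :=
  let U := orbit6 (16, 0, 0, 0)%BZ ++ orbit6 (14, 0, 2, 0)%BZ in
  [seq [:: u] | u <- U ++ orbit6 (-4, 0, 4, 0)%BZ] ++
  [seq let v := padd u (rot60 u) in [:: v; rot60 v] | u <- U].

Definition linked_seeds : seq (pt * nat) :=
  [:: ((32, 0, 0, 0), 0%N); ((-32, 0, 0, 0), 1%N)]%BZ.

Definition linked_branches : seq positive := [::
    1; 4; 5; 2; 11; 32; 41; 33; 41; 33; 41; 33; 32; 41; 33; 41; 33; 41;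
    33; 2; 32; 41; 33; 41; 33; 41; 33; 11; 32; 41; 33; 41; 33; 41; 33; 2;
    32; 49; 36; 49; 36; 49; 36; 17; 32; 49; 36; 49; 36; 49; 36; 2; 17; 32;
    49; 36; 49; 36; 49; 36; 32; 49; 36; 49; 36; 49; 36; 3; 2; 5; 11; 33;
    43; 34; 43; 34; 43; 34; 33; 43; 34; 43; 34; 43; 34; 5; 33; 43; 34; 43;
    34; 43; 34; 11; 33; 43; 34; 43; 34; 43; 34; 5; 34; 45; 35; 45; 35; 45;
    35; 17; 34; 45; 35; 45; 35; 45; 35; 5; 17; 34; 45; 35; 45; 35; 45; 35;
    34; 45; 35; 45; 35; 45; 35; 3; 6; 2; 4; 4; 3; 6; 2; 4; 4]%positive.

Lemma linked_uncolorable :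
  uncolorable (fun l => edge 15 16 l || triangle 15 16 l) linked_shapes
    linked_points linked_seeds linked_branches.
Proof. by vm_compute. Qed.

(** Normalizes the seed colors. The second transposition fixes 0 because the first does not send [b]
    there. *)
Lemma recolor (a b : 'I_4) : a != b ->
  exists s : {perm 'I_4}, s a = 0 :> nat /\ s b = 1 :> nat.
Proof.
pose i0 : 'I_4 := ord0; pose i1 : 'I_4 := Ordinal (isT : 1 < 4) => ab.
have b0 : tperm a i0 b != i0.
  by rewrite -[X in _ != X](tpermL a i0) (inj_eq perm_inj) eq_sym.
exists (tperm a i0 * tperm (tperm a i0 b) i1)%g.
by rewrite !permM !tpermL [tperm _ i1 _]tpermD.
Qed.

(** * Colorings of the plane *)

Local Open Scope ring_scope.

Section Plane.
Variable R : realType.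
Implicit Types (P Q S U : R * R) (c : R * R -> 'I_4) (p q : pt).

Definition sqdist P Q : R := (P.1 - Q.1) ^+ 2 + (P.2 - Q.2) ^+ 2.

Definition unit_proper c : Prop := forall P Q, sqdist P Q = 1 -> c P != c Q.

Definition ofZ (z : Z) : R := (int_of_Z z)%:~R.

Lemma ofZD : {morph ofZ : x y / Z.add x y >-> x + y}.
Proof. by move=> x y; rewrite /ofZ -intrD; congr _%:~R; lia. Qed.

Lemma ofZB : {morph ofZ : x y / Z.sub x y >-> x - y}.
Proof. by move=> x y; rewrite /ofZ -intrB; congr _%:~R; lia. Qed.

Lemma ofZM : {morph ofZ : x y / Z.mul x y >-> x * y}.
Proof. by move=> x y; rewrite /ofZ -intrM; congr _%:~R; lia. Qed.

Lemma ofZN : {morph ofZ : x / Z.opp x >-> - x}.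
Proof. by move=> x; rewrite /ofZ -mulrNz; congr _%:~R; lia. Qed.

Lemma ofZ_nat n : ofZ (Z.of_nat n) = n%:R.
Proof. by rewrite /ofZ -[RHS]/(n%:Z%:~R); congr _%:~R; lia. Qed.

Definition embed (m D : Z) (p : pt) : R * R :=
  let: (x, y, z, t) := p in
  let a := Num.sqrt 3 in let b := Num.sqrt (ofZ m) in
  ((ofZ x + ofZ t * (a * b)) / ofZ D, (ofZ y * a + ofZ z * b) / ofZ D).

Lemma sqdist_embed m D n p q : 0 <= ofZ m -> ofZ D != 0 ->
  sqdist_is m (n * (D * D)) p q -> sqdist (embed m D p) (embed m D q) = ofZ n.
Proof.
move: p q => [[[x y] z] t] [[[x' y'] z'] t'] m0 D0 /andP[/Z.eqb_eq + /Z.eqb_eq].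
move/(congr1 ofZ); rewrite !(ofZD, ofZM, ofZB) => + /(congr1 ofZ).
rewrite !(ofZD, ofZM, ofZB) /sqdist /= => eqr eqs.
have a2 : Num.sqrt 3 ^+ 2 = 3 :> R by rewrite sqr_sqrtr.
have b2 : Num.sqrt (ofZ m) ^+ 2 = ofZ m by rewrite sqr_sqrtr.
move: (Num.sqrt 3) (Num.sqrt (ofZ m)) a2 b2 => a b a2 b2.
have [X XE] : {X | X = ofZ x - ofZ x'} by exists (ofZ x - ofZ x').
have [Y YE] : {Y | Y = ofZ y - ofZ y'} by exists (ofZ y - ofZ y').
have [Z ZE] : {Z | Z = ofZ z - ofZ z'} by exists (ofZ z - ofZ z').
have [T TE] : {T | T = ofZ t - ofZ t'} by exists (ofZ t - ofZ t').
move: eqr eqs; rewrite -XE -YE -ZE -TE => eqr eqs.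
have o3 : ofZ 3 = 3 by [].
have o0 : ofZ 0 = 0 by [].
transitivity (((X + T * (a * b)) ^+ 2 + (Y * a + Z * b) ^+ 2) / ofZ D ^+ 2).
  by rewrite XE YE ZE TE; field.
apply/(canLR (mulfK (expf_neq0 2 D0))).
(* The last term is the irrational part, which vanishes by [eqs]. *)
transitivity (X * X + a ^+ 2 * (Y * Y) + b ^+ 2 * (Z * Z)
   + a ^+ 2 * b ^+ 2 * (T * T) + 2 * a * b * (X * T + Y * Z)); first by ring.
rewrite eqs a2 b2 -o3 eqr o0; ring.
Qed.

(** In complex notation this is P + U Q, a rigid motion when |U| = 1. *)
Definition transport U P Q : R * R :=
  (P.1 + U.1 * Q.1 - U.2 * Q.2, P.2 + U.2 * Q.1 + U.1 * Q.2).

Lemma unit_proper_transport U P c : U.1 ^+ 2 + U.2 ^+ 2 = 1 ->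
  unit_proper c -> unit_proper (c \o transport U P).
Proof.
move=> U1 cP Q S QS; apply: cP; rewrite -QS -[RHS]mul1r -U1 /sqdist /=; ring.
Qed.

Lemma embedded_contradiction m D forbidden shapes ps s bs c (a b : 'I_4) :
  uncolorable forbidden shapes ps s bs ->
  (forall l, forbidden l -> ~~ constant (map (c \o embed m D) l)) ->
  all (fun x => c (embed m D x.1) == if x.2 is 0%N then a else b) s ->
  all (fun x => x.2 < 2)%N s -> a != b -> False.
Proof.
move=> run cl cs s2 /recolor[sg [sa sb]].
apply: (uncolorable_sound (f := fun p => val (sg (c (embed m D p)))) run).
- by move=> p; apply: ltn_ord.
- move=> l /cl; apply: contra; case: l => //= p l; rewrite !all_map.
  by apply: sub_all => q /=; rewrite !(inj_eq val_inj) (inj_eq perm_inj).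
- elim: s {run} cs s2 => //= -[p k] s IHs /andP[/= /eqP-> cs] /andP[k2 s2].
  by rewrite IHs // andbT; case: k k2 => [|[|]] // _; apply/eqP.
Qed.

Lemma edge_not_constant m D c l : 0 <= ofZ m -> ofZ D != 0 -> unit_proper c ->
  edge m D l -> ~~ constant (map (c \o embed m D) l).
Proof.
move=> m0 D0 cP; case: l => [|p [|q [|? ?]]] //=; rewrite /edge /= !andbT => pq.
by rewrite eq_sym cP // (@sqdist_embed m D 1) // Z.mul_1_l.
Qed.

(** * Triangles of side sqrt 3 and points at distance 4 *)

Lemma no_unit_circle_triangle c : unit_proper c ->
  c (1, 0) = c (- (1 / 2), Num.sqrt 3 / 2) ->
  c (1, 0) = c (- (1 / 2), - (Num.sqrt 3 / 2)) -> False.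
Proof.
move=> cP e1 e2; have ab : c (0, 0) != c (1, 0).
  by apply: cP; rewrite /sqdist /=; ring.
have o6 : ofZ 6 = 6 := ofZ_nat 6.
have o12 : ofZ 12 = 12 := ofZ_nat 12.
have o11 : ofZ 11 = 11 := ofZ_nat 11.
have on6 : ofZ (-6) = - 6 by rewrite -o6 -ofZN.
apply: (embedded_contradiction (m := 11) (D := 12) de_grey_uncolorable _ _ _ ab) => //.
  by move=> l; apply: (edge_not_constant _ _ cP); rewrite ?o11 ?o12 ?ler0n ?pnatr_eq0.
rewrite /= o6 on6 o12 -[ofZ 0]/0 !mul0r !addr0; apply/and5P; split=> //; apply/eqP.
- by congr c; congr pair; field.
- by congr c; congr pair; field.
- by rewrite e1; congr c; congr pair; field.
- by rewrite e2; congr c; congr pair; field.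
Qed.

Lemma no_sqrt3_triangle c P Q S : unit_proper c ->
  sqdist P Q = 3 -> sqdist Q S = 3 -> sqdist S P = 3 ->
  c P = c Q -> c P = c S -> False.
Proof.
move=> cP; rewrite /sqdist; pose t : R := Num.sqrt 3.
have t2 : t ^+ 2 = 3 by rewrite sqr_sqrtr.
(* The cross product squares to 27/4 by Lagrange's identity, and swapping [Q] and [S] changes its
   sign. *)
wlog cross : Q S / (Q.1 - P.1) * (S.2 - P.2) - (Q.2 - P.2) * (S.1 - P.1) = 3 / 2 * t.
  move=> wl PQ QS SP.
  have dot : (Q.1 - P.1) * (S.1 - P.1) + (Q.2 - P.2) * (S.2 - P.2) = 3 / 2 by lra.
  have : ((Q.1 - P.1) * (S.2 - P.2) - (Q.2 - P.2) * (S.1 - P.1)) ^+ 2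
      == (3 / 2 * t) ^+ 2.
    rewrite exprMn t2; apply/eqP.
    transitivity (((P.1 - Q.1) ^+ 2 + (P.2 - Q.2) ^+ 2) *
        ((S.1 - P.1) ^+ 2 + (S.2 - P.2) ^+ 2) -
        ((Q.1 - P.1) * (S.1 - P.1) + (Q.2 - P.2) * (S.2 - P.2)) ^+ 2); first by ring.
    by rewrite PQ SP dot; field.
  rewrite eqf_sqr => /orP[] /eqP cross cQ cS; first exact: (wl Q S).
  by apply: (wl S Q) => //; lra.
case: P Q S cross => [p1 p2] [q1 q2] [s1 s2] /= cross PQ QS SP cQ cS.
have dot : (q1 - p1) * (s1 - p1) + (q2 - p2) * (s2 - p2) = 3 / 2 by lra.
(* For v = Q - P and w = S - P, this is |v|^2 w = (v.w) v + (v x w) i v: w is v turned by 60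
   degrees. *)
have s1E : 3 * (s1 - p1) = (q1 - p1) * (3 / 2) - (q2 - p2) * (3 / 2 * t).
  transitivity (((p1 - q1) ^+ 2 + (p2 - q2) ^+ 2) * (s1 - p1)); first by rewrite PQ.
  by rewrite -cross -dot; ring.
have s2E : 3 * (s2 - p2) = (q2 - p2) * (3 / 2) + (q1 - p1) * (3 / 2 * t).
  transitivity (((p1 - q1) ^+ 2 + (p2 - q2) ^+ 2) * (s2 - p2)); first by rewrite PQ.
  by rewrite -cross -dot; ring.
have {}s1E : s1 = p1 + ((q1 - p1) - t * (q2 - p2)) / 2 by lra.
have {}s2E : s2 = p2 + ((q2 - p2) + t * (q1 - p1)) / 2 by lra.
(* The centroid [o] is at distance 1 from the vertices, and [transport U o] takes the cube roots of
   unity to them. *)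
pose o := ((p1 + q1 + s1) / 3, (p2 + q2 + s2) / 3).
pose U := (p1 - o.1, p2 - o.2).
have tt x : t * (t * x) = 3 * x by rewrite mulrA -expr2 t2.
have [tp1 tp2 tq1 tq2] := And4 (tt p1) (tt p2) (tt q1) (tt q2).
have pE : transport U o (1, 0) = (p1, p2).
  by rewrite /transport /U /=; congr pair; ring.
apply: (@no_unit_circle_triangle (c \o transport U o)).
- apply: unit_proper_transport cP => /=; nra.
- rewrite /comp pE cQ; congr c; rewrite /transport /U /o s1E s2E /=.
  by congr pair; rewrite -/t; lra.
- rewrite /comp pE cS; congr c; rewrite /transport /U /o s1E s2E /=.
  by congr pair; rewrite -/t; lra.
Qed.

Lemma triangle_not_constant m D c l : 0 <= ofZ m -> ofZ D != 0 -> unit_proper c ->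
  triangle m D l -> ~~ constant (map (c \o embed m D) l).
Proof.
move=> m0 D0 cP; case: l => [|p [|q [|s [|? ?]]]] //=.
rewrite /triangle /= !andbT => /andP[/andP[pq ps] qs].
apply/negP => /andP[/eqP cq /eqP cs].
have dE u v := @sqdist_embed m D 3 u v m0 D0.
have sp : sqdist (embed m D s) (embed m D p) = 3.
  by rewrite -[RHS](dE _ _ ps) /sqdist; ring.
by apply: (@no_sqrt3_triangle c _ _ _ cP (dE _ _ pq) (dE _ _ qs) sp).
Qed.

Lemma distance4_same_color c P Q : unit_proper c -> sqdist P Q = 16 -> c P = c Q.
Proof.
move=> cP PQ; apply/eqP/negPn/negP => cPQ.
(* The motion [transport U o] takes the seed positions (2, 0) and (-2, 0) to [P] and [Q]. *)
pose o := ((P.1 + Q.1) / 2, (P.2 + Q.2) / 2).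
pose U := ((P.1 - o.1) / 2, (P.2 - o.2) / 2).
have c'P : unit_proper (c \o transport U o).
  by apply: unit_proper_transport cP => /=; move: PQ; rewrite /sqdist; nra.
have o16 : ofZ 16 = 16 := ofZ_nat 16.
have o15 : ofZ 15 = 15 := ofZ_nat 15.
have o32 : ofZ 32 = 32 := ofZ_nat 32.
have on32 : ofZ (-32) = - 32 by rewrite -o32 -ofZN.
have m0 : 0 <= ofZ 15 by rewrite o15.
have D0 : ofZ 16 != 0 by rewrite o16 pnatr_eq0.
apply: (embedded_contradiction (m := 15) (D := 16) linked_uncolorable _ _ _ cPQ) => //.
  move=> l /orP[]; first exact: (edge_not_constant m0 D0 c'P).
  exact: (triangle_not_constant m0 D0 c'P).
rewrite /= o32 on32 o16 -[ofZ 0]/0 !mul0r !addr0 andbT; apply/andP.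
by split; apply/eqP; congr c; rewrite /transport /= [RHS]surjective_pairing;
  congr pair; field.
Qed.

Lemma no_unit_proper c : ~ unit_proper c.
Proof.
move=> cP; have r63 : Num.sqrt 63 ^+ 2 = 63 :> R by rewrite sqr_sqrtr.
have c4 : c (0, 0) = c (4, 0).
  by apply: distance4_same_color; rewrite // /sqdist /=; ring.
(* This point is (4, 0) turned about the origin by the angle of cosine 31/32, which moves it by
   distance 1. *)
have c4' : c (0, 0) = c (31 / 8, Num.sqrt 63 / 8).
  apply: distance4_same_color; rewrite // /sqdist /= !sub0r !sqrrN !expr_div_n r63.
  by field.
suff /cP/eqP : sqdist (4, 0) (31 / 8, Num.sqrt 63 / 8) = 1 by rewrite -c4 -c4'.
by rewrite /sqdist /= sub0r sqrrN !expr_div_n r63; field.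
Qed.

End Plane.

Theorem mainTheorem1 (R : realType) :
  (5 <= chromatic_number_plane R)%N /\
  (forall c : 'rV[R]_2 -> 'I_4,
     exists x y : 'rV[R]_2, euclidean_norm (x - y) = 1 /\ c x = c y).
Proof.
have mono_pair (c : 'rV[R]_2 -> 'I_4) :
    exists x y : 'rV[R]_2, euclidean_norm (x - y) = 1 /\ c x = c y.
  pose vec (P : R * R) : 'rV[R]_2 := \row_i (if i == 0 then P.1 else P.2).
  apply: contrapT => no; apply: (@no_unit_proper R (c \o vec)) => P Q PQ.
  apply/eqP => cPQ; apply: no; exists (vec P), (vec Q); split=> //.
  rewrite /euclidean_norm !big_ord_recl big_ord0 addr0 !mxE /=.
  by move: PQ; rewrite /sqdist => ->; rewrite sqrtr1.
split=> //; rewrite /chromatic_number_plane; case: ex_minnP => k /asboolP[c cP] _.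
(* A proper coloring with at most 4 colors is in particular one with colors in ['I_4]. *)
rewrite leqNgt; apply/negP => k4; have {}k4 : (k <= 4)%N by [].
have [x [y [xy /(congr1 val)/= cxy]]] := mono_pair (widen_ord k4 \o c).
by apply: (cP x y xy); apply/val_inj.
Qed.
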